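(* Let $(y_i,p_i)$, $0\le i\le n$, be Hermite data with $y_i-y_{i-1}>0$ for $1\le i\le n$ and $p_i>0$ for $0\le i\le n$. For $1\le i\le n$ let $\tau_i=\frac{y_i-y_{i-1}}{h_i}$ and $\mu_i=\frac12(p_{i-1}+p_i)$. For a choice of parameters $\theta_i\in\,]0,\frac14]$, $1\le i\le n$, let $g\in GS_2(I,X,\beta)$, with $\beta_i=\frac{-2\theta_i}{1-2\theta_i}$, be the unique generalized quadratic spline with $g(x_i)=y_i$ and $g'(x_i)=p_i$ for $0\le i\le n$. Then for each $1\le i\le n$: (i) if $\mu_i\le 2\tau_i$, one can choose $\theta_i=\frac14$, i.e. with this choice $g$ is increasing on $I_i$; in that case $\beta_i=-1$ and the local interpolant $g|_{I_i}$ is an ordinary quadratic spline; (ii) if $\mu_i>2\tau_i$, then $\bar\theta_i:=\frac12\frac{\tau_i}{\mu_i}<\frac14$ and one has to choose $\theta_i\le\bar\theta_i$, i.e. $g$ is increasing on $I_i$ if and only if $\theta_i\le\bar\theta_i$; in that case the local interpolant $g|_{I_i}$ is a generalized quadratic spline associated with the parameter $\beta_i=\frac{-2\theta_i}{1-2\theta_i}$.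
   Context: Setting. Let $n\ge 1$, $I=[a,b]$, $X=\{a=x_0<x_1<\dots<x_n=b\}$ a partition of $I$, $I_i=[x_{i-1},x_i]$, $h_i=x_i-x_{i-1}$ for $1\le i\le n$. Let $\beta=(\beta_1,\dots,\beta_n)$ with $\beta_i\in[-1,0[$ and $\theta_i=\frac12\frac{\beta_i}{\beta_i-1}\in\,]0,\frac14]$ (equivalently $\beta_i=\frac{-2\theta_i}{1-2\theta_i}$). The space $V(\beta_i)$ (generated by the Merrien subdivision algorithm) is the set of $C^1$ functions $f$ on $I_i$ such that for every dyadic subinterval $[u,v]$ of $I_i$ (i.e. every interval obtained from $I_i$ by repeated bisection, including $I_i$ itself), with $m=\frac12(u+v)$ and $h=v-u$, $$f(m)=\tfrac12\big(f(u)+f(v)-\theta_i h\,(f'(v)-f'(u))\big),\qquad f'(m)=\frac{1}{1-2\theta_i}\Big(\frac{f(v)-f(u)}{h}-2\theta_i\,\frac{f'(u)+f'(v)}{2}\Big).$$ It is known that for any prescribed values of $f,f'$ at the two endpoints of $I_i$ there is exactly one such $f$; so $\dim V(\beta_i)=4$. $GS_2(\beta)=GS_2(I,X,\beta)$ is the space of all $g\in C^1(I)$ with $g|_{I_i}\in V(\beta_i)$ for all $1\le i\le n$ (generalized quadratic splines). Each $g$ is uniquely determined by the Hermite data $g(x_i),g'(x_i)$, $0\le i\le n$, which can be prescribed arbitrarily. ''Increasing'' is understood in the weak sense (nondecreasing). An ordinary quadratic spline on $I_i$ means a $C^1$ piecewise quadratic polynomial with a single knot at the midpoint of $I_i$.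 *)

(* Defs.v *)
From Stdlib Require Import Reals.

Open Scope R_scope.

Definition Icc (c d : R) : R -> Prop := fun t => c <= t <= d.

(* [D_in] takes the limit of the difference quotient within the given domain,
   so the derivative is one-sided at the endpoints of [c, d]. *)
Definition deriv_on (c d : R) (f df : R -> R) : Prop :=
  forall t, Icc c d t -> D_in f df (Icc c d) t.

Definition cont_on (c d : R) (f : R -> R) : Prop :=
  forall t, Icc c d t -> continue_in f (Icc c d) t.

Definition C1_on (c d : R) (f : R -> R) : Prop :=
  exists df, deriv_on c d f df /\ cont_on c d df.

Definition increasing_on (c d : R) (f : R -> R) : Prop :=
  forall s t, c <= s -> s <= t -> t <= d -> f s <= f t.

(* [dyadic c d u v]: [u, v] is obtained from [c, d] by repeated bisection. *)
Inductive dyadic (c d : R) : R -> R -> Prop :=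
| dyadic_self : dyadic c d c d
| dyadic_left u v : dyadic c d u v -> dyadic c d u ((u + v) / 2)
| dyadic_right u v : dyadic c d u v -> dyadic c d ((u + v) / 2) v.

Definition theta_of_beta (beta : R) : R := 1 / 2 * (beta / (beta - 1)).

Definition beta_of_theta (theta : R) : R := - 2 * theta / (1 - 2 * theta).

(* The space V(beta) on [c, d] of limits of the Merrien subdivision scheme.
   Functions are total on R; only the values of [f] on [c, d] matter. *)
Definition V (c d beta : R) (f : R -> R) : Prop :=
  exists df, deriv_on c d f df /\ cont_on c d df /\
    let theta := theta_of_beta beta in
    forall u v, dyadic c d u v ->
      let m := (u + v) / 2 in
      let h := v - u in
      f m = 1 / 2 * (f u + f v - theta * h * (df v - df u)) /\
      df m = 1 / (1 - 2 * theta) *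
             ((f v - f u) / h - 2 * theta * ((df u + df v) / 2)).

(* Only [x 0], ..., [x n] are used. *)
Definition is_partition (a b : R) (n : nat) (x : nat -> R) : Prop :=
  x 0%nat = a /\ x n = b /\
  forall i, (1 <= i <= n)%nat -> x (i - 1)%nat < x i.

(* Generalized quadratic splines; [beta i] belongs to [x (i - 1), x i],
   for 1 <= i <= n. *)
Definition GS2 (a b : R) (n : nat) (x beta : nat -> R) (g : R -> R) : Prop :=
  C1_on a b g /\
  forall i, (1 <= i <= n)%nat -> V (x (i - 1)%nat) (x i) (beta i) g.

Definition quadratic_on (c d : R) (f : R -> R) : Prop :=
  exists a0 a1 a2 : R, forall t, Icc c d t -> f t = a0 + a1 * t + a2 * t ^ 2.

Definition quadratic_spline_on (c d : R) (f : R -> R) : Prop :=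
  C1_on c d f /\
  quadratic_on c ((c + d) / 2) f /\ quadratic_on ((c + d) / 2) d f.

(* Main.v *)
Require Import Defs.
From Stdlib Require Import Reals Lra Lia.

Open Scope R_scope.

(** Let [u, v] be a dyadic interval of length [h], with slope
    [tau = (f v - f u) / h] and end derivatives [p], [q].  One bisection gives
    the midpoint derivative [r] with [(1 - 2 theta) r = tau - theta (p + q)] and
    the slopes [tau - theta (q - p)] and [tau + theta (q - p)] on the two halves.
    Everything is read off from these formulas.

    Sufficiency.  For [0 < theta <= 1/4] the condition that [p], [q] and
    [tau - theta (p + q)] are nonnegative is inherited by both halves: for the
    left half the last quantity becomes [(1 - 3 theta) r + theta p], and for the
    right half [(1 - 3 theta) r + theta q] ([bisection_invariant]).  It therefore
    holds on all dyadic intervals as soon as it holds on the whole interval,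
    where it says [theta <= tau / (2 mu)].  It makes [f] increase between the
    ends of each dyadic interval, hence everywhere, because [f] is continuous and
    dyadic points are dense ([increasing_of_dyadic]).

    Necessity.  If [f] is increasing, then its derivative [r] at the midpoint of
    the whole interval is nonnegative, which is [theta (p + q) <= tau].

    The case [theta = 1/4].  After one bisection the slope on each half is the
    mean of the derivatives at its ends.  Such Hermite data belong to a quadratic
    polynomial, and bisection with [theta = 1/4] reproduces that polynomial, so
    [f] agrees with it at all dyadic points of the half and then everywhere
    ([quadratic_of_mean_slope]). *)

(** * Continuity and derivatives on a closed interval *)

Lemma cont_on_eps c d f t eps :
  cont_on c d f -> Icc c d t -> 0 < eps ->
  exists delta, 0 < delta /\
    forall s, Icc c d s -> Rabs (s - t) < delta -> Rabs (f s - f t) < eps.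
Proof.
  intros Hf Ht Heps.
  destruct (Hf t Ht eps Heps) as [delta [Hd H]].
  exists delta; split; [exact Hd|].
  intros s Hs Hst.
  (* The limit in [continue_in] leaves out the point [t] itself. *)
  destruct (Req_dec t s) as [->|Hne].
  - rewrite Rminus_diag, Rabs_R0; exact Heps.
  - apply (H s); repeat split; try apply Hs; assumption.
Qed.

Lemma cont_on_restrict c d c' d' f :
  c <= c' -> d' <= d -> cont_on c d f -> cont_on c' d' f.
Proof.
  intros Hc Hd Hf t [H1 H2].
  apply limit1_imp with (D_x (Icc c d) t).
  - intros s [[H3 H4] Hne]; split; [split; lra|exact Hne].
  - apply Hf; split; lra.
Qed.

Lemma cont_on_of_continuity c d f : continuity f -> cont_on c d f.
Proof.
  intros Hf t _.
  apply limit1_imp with (D_x no_cond t).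
  - intros s [_ Hne]; split; [exact I|exact Hne].
  - exact (Hf t).
Qed.

Lemma cont_on_of_deriv_on c d f df : deriv_on c d f df -> cont_on c d f.
Proof.
  intros Hf t Ht; apply cont_deriv with df; exact (Hf t Ht).
Qed.

Lemma deriv_on_restrict c d c' d' f df :
  c <= c' -> d' <= d -> deriv_on c d f df -> deriv_on c' d' f df.
Proof.
  intros Hc Hd Hf t [H1 H2].
  apply limit1_imp with (D_x (Icc c d) t).
  - intros s [[H3 H4] Hne]; split; [split; lra|exact Hne].
  - apply Hf; split; lra.
Qed.

(** One-sided derivatives at the endpoints are unique because every point of a
    nondegenerate interval is an accumulation point of it. *)
Lemma deriv_on_unique c d f df df' t :
  c < d -> deriv_on c d f df -> deriv_on c d f df' -> Icc c d t -> df t = df' t.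
Proof.
  intros Hcd H1 H2 Ht.
  apply (single_limit (fun s => (f s - f t) / (s - t)) (D_x (Icc c d) t)
           (df t) (df' t) t); [|apply H1, Ht|apply H2, Ht].
  intros eps Heps.
  unfold D_x, Icc, R_dist in *.
  destruct (Rlt_le_dec t d) as [Hlt|Hge].
  - exists (t + Rmin (eps / 2) (d - t)).
    assert (Hm : 0 < Rmin (eps / 2) (d - t)) by (apply Rmin_pos; lra).
    pose proof (Rmin_l (eps / 2) (d - t)).
    pose proof (Rmin_r (eps / 2) (d - t)).
    repeat split; try lra.
    unfold Rdist; rewrite Rabs_pos_eq; lra.
  - exists (t - Rmin (eps / 2) (t - c)).
    assert (Hm : 0 < Rmin (eps / 2) (t - c)) by (apply Rmin_pos; lra).
    pose proof (Rmin_l (eps / 2) (t - c)).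
    pose proof (Rmin_r (eps / 2) (t - c)).
    repeat split; try lra.
    unfold Rdist; rewrite Rabs_left; lra.
Qed.

Lemma increasing_on_deriv_nonneg c d f df t :
  deriv_on c d f df -> increasing_on c d f -> c <= t < d -> 0 <= df t.
Proof.
  intros Hf Hinc Ht.
  destruct (Rle_or_lt 0 (df t)) as [H|Hneg]; [exact H|exfalso].
  destruct (Hf t) with (eps := - df t) as [delta [Hd H]]; [split; lra|lra|].
  set (e := Rmin (delta / 2) (d - t)).
  assert (He : 0 < e) by (apply Rmin_pos; lra).
  assert (He1 : e <= delta / 2) by apply Rmin_l.
  assert (He2 : e <= d - t) by apply Rmin_r.
  assert (Hq : Rabs ((f (t + e) - f t) / (t + e - t) - df t) < - df t).
  { apply (H (t + e)); split.
    - split; [split; lra|lra].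
    - cbn; unfold Rdist; rewrite Rabs_pos_eq; lra. }
  assert (Hq0 : 0 <= (f (t + e) - f t) / (t + e - t)).
  { apply Rle_mult_inv_pos; [|lra].
    assert (f t <= f (t + e)) by (apply Hinc; lra); lra. }
  rewrite Rabs_pos_eq in Hq; lra.
Qed.

(** * Dyadic subintervals *)

Lemma dyadic_bounds c d u v :
  c < d -> dyadic c d u v -> c <= u /\ u < v /\ v <= d.
Proof.
  intros Hcd H; induction H; lra.
Qed.

Lemma dyadic_trans c d u v w z :
  dyadic c d u v -> dyadic u v w z -> dyadic c d w z.
Proof.
  intros H K; induction K.
  - exact H.
  - now apply dyadic_left.
  - now apply dyadic_right.
Qed.

Lemma dyadic_at_depth c d t k :
  Icc c d t ->
  exists u v, dyadic c d u v /\ u <= t <= v /\ v - u = (d - c) * (1 / 2) ^ k.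
Proof.
  intros Ht; induction k as [|k (u & v & Huv & Hin & Hlen)].
  - exists c, d; split; [apply dyadic_self|split; [exact Ht|simpl; ring]].
  - simpl; destruct (Rle_or_lt t ((u + v) / 2)).
    + exists u, ((u + v) / 2); split; [now apply dyadic_left|lra].
    + exists ((u + v) / 2), v; split; [now apply dyadic_right|lra].
Qed.

Lemma dyadic_dense c d t eps :
  c < d -> Icc c d t -> 0 < eps ->
  exists u v, dyadic c d u v /\ u <= t <= v /\ v - u < eps.
Proof.
  intros Hcd Ht Heps.
  destruct (pow_lt_1_zero (1 / 2)) with (y := eps / (d - c)) as [k Hk].
  - rewrite Rabs_pos_eq; lra.
  - apply Rdiv_lt_0_compat; lra.
  - destruct (dyadic_at_depth c d t k Ht) as (u & v & Huv & Hin & Hlen).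
    exists u, v; repeat split; try assumption; try apply Hin.
    specialize (Hk k (le_n k)).
    rewrite Rabs_pos_eq in Hk by (apply pow_le; lra).
    rewrite Hlen.
    apply Rmult_lt_compat_l with (r := d - c) in Hk; [|lra].
    replace ((d - c) * (eps / (d - c))) with eps in Hk by (field; lra).
    exact Hk.
Qed.

Lemma cont_le_of_dyadic c d f g :
  c < d -> cont_on c d f -> cont_on c d g ->
  (forall u v, dyadic c d u v -> f u <= g u) ->
  forall t, Icc c d t -> f t <= g t.
Proof.
  intros Hcd Hf Hg H t Ht.
  destruct (Rle_or_lt (f t) (g t)) as [|Hlt]; [assumption|exfalso].
  set (eps := (f t - g t) / 2).
  assert (Heps : 0 < eps) by (unfold eps; lra).
  destruct (cont_on_eps c d f t eps Hf Ht Heps) as [d1 [Hd1 H1]].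
  destruct (cont_on_eps c d g t eps Hg Ht Heps) as [d2 [Hd2 H2]].
  destruct (dyadic_dense c d t (Rmin d1 d2) Hcd Ht) as (u & v & Huv & Hin & Hlen).
  { now apply Rmin_pos. }
  pose proof (Rmin_l d1 d2); pose proof (Rmin_r d1 d2).
  pose proof (dyadic_bounds c d u v Hcd Huv).
  assert (Hu : Icc c d u) by (split; lra).
  assert (Hut : Rabs (u - t) = t - u) by (rewrite Rabs_left1; lra).
  specialize (H1 u Hu ltac:(lra)); specialize (H2 u Hu ltac:(lra)).
  apply Rabs_def2 in H1; apply Rabs_def2 in H2.
  specialize (H u v Huv); unfold eps in *; lra.
Qed.

(** * Monotonicity from dyadic intervals *)

Section DyadicMonotone.

Variables (c d : R) (f : R -> R).
Hypothesis Hcd : c < d.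
Hypothesis Hf : cont_on c d f.
Hypothesis Hmono : forall u v, dyadic c d u v -> f u <= f v.

(** Following the bisections that lead to a smaller dyadic interval, the values
    at its ends stay between the values at the ends of the larger one; density
    carries this over to all points. *)
Lemma dyadic_between u v t :
  dyadic c d u v -> u <= t <= v -> f u <= f t <= f v.
Proof.
  intros Huv Ht.
  pose proof (dyadic_bounds c d u v Hcd Huv) as Hb.
  assert (Hnest : forall w z, dyadic u v w z -> f u <= f w /\ f z <= f v).
  { intros w z K; induction K as [|w z K [IH1 IH2]|w z K [IH1 IH2]].
    - split; apply Rle_refl.
    - assert (f ((w + z) / 2) <= f z)
        by (apply Hmono, dyadic_right, dyadic_trans with u v; assumption).
      lra.
    - assert (f w <= f ((w + z) / 2))
        by (apply Hmono, dyadic_left, dyadic_trans with u v; assumption).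
      lra. }
  assert (Hcf : cont_on u v f) by (apply cont_on_restrict with c d; (lra || assumption)).
  assert (Hk : forall k, cont_on u v (fun _ => k))
    by (intros k; apply cont_on_of_continuity; reg).
  split.
  - apply (cont_le_of_dyadic u v (fun _ => f u) f); try assumption; try apply Hk; try lra.
    intros w z K; apply (Hnest w z K).
  - apply (cont_le_of_dyadic u v f (fun _ => f v)); try assumption; try apply Hk; try lra.
    intros w z K; destruct (Hnest w z K).
    assert (f w <= f z) by (apply Hmono, dyadic_trans with u v; assumption).
    lra.
Qed.

Lemma dyadic_outside u v t :
  dyadic c d u v -> (c <= t <= u -> f t <= f u) /\ (v <= t <= d -> f v <= f t).
Proof.
  intros Huv; induction Huv as [|u v Huv [IH1 IH2]|u v Huv [IH1 IH2]].
  - split; intros Ht; [replace t with c by lra|replace t with d by lra];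
      apply Rle_refl.
  - split; [exact IH1|intros Ht].
    pose proof (dyadic_between _ _ t (dyadic_right _ _ _ _ Huv)).
    assert (f ((u + v) / 2) <= f v) by (apply Hmono; now apply dyadic_right).
    destruct (Rle_or_lt t v); [apply H; lra|].
    assert (f v <= f t) by (apply IH2; lra); lra.
  - split; [intros Ht|exact IH2].
    pose proof (dyadic_between _ _ t (dyadic_left _ _ _ _ Huv)).
    assert (f u <= f ((u + v) / 2)) by (apply Hmono; now apply dyadic_left).
    destruct (Rle_or_lt u t); [apply H; lra|].
    assert (f t <= f u) by (apply IH1; lra); lra.
Qed.

(** Between [s < t] there is an end [v] of a dyadic interval containing [s];
    the comparison goes through [f v]. *)
Lemma increasing_of_dyadic : increasing_on c d f.
Proof.
  intros s t Hs Hst Ht.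
  destruct (Req_dec s t) as [->|Hne]; [apply Rle_refl|].
  destruct (dyadic_dense c d s (t - s) Hcd) as (u & v & Huv & Hin & Hlen);
    [split; lra|lra|].
  apply Rle_trans with (f v).
  - apply (dyadic_between u v s Huv Hin).
  - apply (dyadic_outside u v t Huv); lra.
Qed.

End DyadicMonotone.

(** * Bisection formulas of the Merrien scheme *)

Definition merrien_bisection (c d theta : R) (f df : R -> R) : Prop :=
  forall u v, dyadic c d u v ->
    f ((u + v) / 2) = 1 / 2 * (f u + f v - theta * (v - u) * (df v - df u)) /\
    df ((u + v) / 2) = 1 / (1 - 2 * theta) *
      ((f v - f u) / (v - u) - 2 * theta * ((df u + df v) / 2)).

Lemma theta_of_beta_of_theta theta :
  theta <= 1 / 4 -> theta_of_beta (beta_of_theta theta) = theta.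
Proof.
  intros H; unfold theta_of_beta, beta_of_theta; field; lra.
Qed.

Lemma merrien_bisection_sub c d theta f df u v :
  dyadic c d u v -> merrien_bisection c d theta f df ->
  merrien_bisection u v theta f df.
Proof.
  intros Huv H w z K; apply H, dyadic_trans with u v; assumption.
Qed.

(** The midpoint derivative is nonnegative because
    [(1 - 2 theta) r h = f v - f u - theta (p + q) h].  For the halves the
    right-hand side becomes [((1 - 3 theta) r + theta p) h / 2] and
    [((1 - 3 theta) r + theta q) h / 2]; the only use of [theta <= 1/4] is that
    [1 - 2 theta] and [1 - 3 theta] are positive. *)
Lemma bisection_invariant c d theta f df :
  c < d -> 0 < theta <= 1 / 4 ->
  merrien_bisection c d theta f df ->
  0 <= df c -> 0 <= df d -> theta * (df c + df d) * (d - c) <= f d - f c ->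
  forall u v, dyadic c d u v ->
    0 <= df u /\ 0 <= df v /\ theta * (df u + df v) * (v - u) <= f v - f u.
Proof.
  intros Hcd Hth Hbis Hc Hd Hs.
  assert (Hstep : forall u v, dyadic c d u v ->
    0 <= df u /\ 0 <= df v /\ theta * (df u + df v) * (v - u) <= f v - f u ->
    0 <= df ((u + v) / 2) /\
    theta * (df u + df ((u + v) / 2)) * ((u + v) / 2 - u) <= f ((u + v) / 2) - f u /\
    theta * (df ((u + v) / 2) + df v) * (v - (u + v) / 2) <= f v - f ((u + v) / 2)).
  { intros u v Huv (Hu & Hv & He).
    pose proof (dyadic_bounds c d u v Hcd Huv) as Hb.
    destruct (Hbis u v Huv) as [Hm Hr].
    set (r := df ((u + v) / 2)) in *; set (h := v - u) in *.
    assert (Hh : 0 < h) by (unfold h; lra).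
    assert (Hrh : (1 - 2 * theta) * r * h = f v - f u - theta * (df u + df v) * h)
      by (rewrite Hr; field; lra).
    assert (Hr0 : 0 <= r).
    { apply Rmult_le_reg_l with ((1 - 2 * theta) * h).
      - apply Rmult_lt_0_compat; lra.
      - lra. }
    assert (H1 : 0 <= (1 - 3 * theta) * r * h)
      by (repeat apply Rmult_le_pos; lra).
    assert (H2 : 0 <= theta * df u * h) by (repeat apply Rmult_le_pos; lra).
    assert (H3 : 0 <= theta * df v * h) by (repeat apply Rmult_le_pos; lra).
    rewrite Hm.
    replace ((u + v) / 2 - u) with (h / 2) by (unfold h; field).
    replace (v - (u + v) / 2) with (h / 2) by (unfold h; field).
    split; [exact Hr0|split; lra]. }
  intros u v Huv; induction Huv as [|u v Huv IH|u v Huv IH].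
  - auto.
  - destruct (Hstep u v Huv IH) as (? & ? & ?); tauto.
  - destruct (Hstep u v Huv IH) as (? & ? & ?); tauto.
Qed.

Lemma merrien_increasing_iff c d theta f df :
  c < d -> 0 < theta <= 1 / 4 ->
  deriv_on c d f df -> merrien_bisection c d theta f df ->
  0 <= df c -> 0 <= df d ->
  increasing_on c d f <-> theta * (df c + df d) * (d - c) <= f d - f c.
Proof.
  intros Hcd Hth Hdf Hbis Hc Hd; split.
  - intros Hinc.
    assert (Hr0 : 0 <= df ((c + d) / 2))
      by (apply increasing_on_deriv_nonneg with c d f; (assumption || lra)).
    destruct (Hbis c d (dyadic_self c d)) as [_ Hr].
    assert (Hrh : (1 - 2 * theta) * df ((c + d) / 2) * (d - c)
                  = f d - f c - theta * (df c + df d) * (d - c))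
      by (rewrite Hr; field; lra).
    assert (0 <= (1 - 2 * theta) * df ((c + d) / 2) * (d - c))
      by (repeat apply Rmult_le_pos; lra).
    lra.
  - intros Hs.
    apply increasing_of_dyadic; [assumption|now apply cont_on_of_deriv_on with df|].
    intros u v Huv.
    destruct (bisection_invariant c d theta f df Hcd Hth Hbis Hc Hd Hs u v Huv)
      as (Hu & Hv & He).
    pose proof (dyadic_bounds c d u v Hcd Huv).
    assert (0 <= theta * (df u + df v) * (v - u))
      by (repeat apply Rmult_le_pos; lra).
    lra.
Qed.

(** * The ordinary quadratic spline *)

(** The slope condition says that the Hermite data at [c] and [d] come from the
    quadratic polynomial [Q] of the proof.  For a quadratic polynomial the
    derivative at the midpoint is the slope, and [theta = 1/4] gives the exact
    midpoint value, so bisection never leaves [Q]. *)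
Lemma quadratic_of_mean_slope c d f df :
  c < d -> cont_on c d f -> merrien_bisection c d (1 / 4) f df ->
  f d - f c = (df c + df d) / 2 * (d - c) ->
  quadratic_on c d f.
Proof.
  intros Hcd Hf Hbis Hs.
  set (k := (df d - df c) / (d - c)).
  set (Q := fun t => f c + df c * (t - c) + k / 2 * (t - c) ^ 2).
  set (dQ := fun t => df c + k * (t - c)).
  assert (Hk : k * (d - c) = df d - df c) by (unfold k; field; lra).
  assert (Hmid : forall u v, dyadic c d u v ->
    (f u = Q u /\ df u = dQ u) /\ (f v = Q v /\ df v = dQ v) ->
    f ((u + v) / 2) = Q ((u + v) / 2) /\ df ((u + v) / 2) = dQ ((u + v) / 2)).
  { intros u v Huv [[Hu Hu'] [Hv Hv']].
    pose proof (dyadic_bounds c d u v Hcd Huv).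
    destruct (Hbis u v Huv) as [-> ->].
    rewrite Hu, Hu', Hv, Hv'; unfold Q, dQ; split; field; lra. }
  assert (HQ : forall u v, dyadic c d u v ->
    (f u = Q u /\ df u = dQ u) /\ (f v = Q v /\ df v = dQ v)).
  { intros u v Huv; induction Huv as [|u v Huv IH|u v Huv IH].
    - unfold Q, dQ; repeat split; try ring.
      + replace (k / 2 * (d - c) ^ 2) with (k * (d - c) * (d - c) / 2) by field.
        rewrite Hk; lra.
      + rewrite Hk; ring.
    - split; [apply IH|now apply Hmid].
    - split; [now apply Hmid|apply IH]. }
  assert (HcQ : cont_on c d Q) by (apply cont_on_of_continuity; unfold Q; reg).
  exists (f c - df c * c + k / 2 * c ^ 2), (df c - k * c), (k / 2).
  intros t Ht.
  transitivity (Q t); [|unfold Q; field].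
  apply Rle_antisym.
  - apply (cont_le_of_dyadic c d f Q); try assumption.
    intros u v Huv; apply Req_le, (HQ u v Huv).
  - apply (cont_le_of_dyadic c d Q f); try assumption.
    intros u v Huv; apply Req_le; symmetry; apply (HQ u v Huv).
Qed.

Lemma merrien_quarter_quadratic_spline c d f df :
  c < d -> deriv_on c d f df -> cont_on c d df ->
  merrien_bisection c d (1 / 4) f df ->
  quadratic_spline_on c d f.
Proof.
  intros Hcd Hdf Hcdf Hbis.
  assert (Hcf : cont_on c d f) by now apply cont_on_of_deriv_on with df.
  destruct (Hbis c d (dyadic_self c d)) as [Hm Hr].
  split; [now exists df|split];
    apply quadratic_of_mean_slope with df; try lra.
  - apply cont_on_restrict with c d; (assumption || lra).
  - apply merrien_bisection_sub with c d; [apply dyadic_left, dyadic_self|assumption].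
  - rewrite Hm, Hr; field; lra.
  - apply cont_on_restrict with c d; (assumption || lra).
  - apply merrien_bisection_sub with c d; [apply dyadic_right, dyadic_self|assumption].
  - rewrite Hm, Hr; field; lra.
Qed.

(** * The interpolation theorem *)

Lemma partition_bounds a b n x i :
  is_partition a b n x -> (i <= n)%nat -> a <= x i <= b.
Proof.
  intros (Ha & Hb & Hlt).
  assert (Hle : forall j k, (j + k <= n)%nat -> x j <= x (j + k)%nat).
  { intros j k; induction k as [|k IH]; intros Hk.
    - rewrite Nat.add_0_r; apply Rle_refl.
    - assert (Hs : x (j + S k - 1)%nat < x (j + S k)%nat) by (apply Hlt; lia).
      replace (j + S k - 1)%nat with (j + k)%nat in Hs by lia.
      specialize (IH ltac:(lia)); lra. }
  intros Hi; split.
  - rewrite <- Ha; apply (Hle 0%nat i Hi).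
  - rewrite <- Hb; replace n with (i + (n - i))%nat by lia.
    apply Hle; lia.
Qed.

Theorem theorem3 (n : nat) (a b : R) (x y p theta : nat -> R) (g dg : R -> R)
  (Hn : (1 <= n)%nat)
  (Hx : is_partition a b n x)
  (Hy : forall i, (1 <= i <= n)%nat -> y i - y (i - 1)%nat > 0)
  (Hp : forall i, (i <= n)%nat -> p i > 0)
  (Htheta : forall i, (1 <= i <= n)%nat -> 0 < theta i <= 1 / 4)
  (Hg : GS2 a b n x (fun i => beta_of_theta (theta i)) g)
  (Hdg : deriv_on a b g dg)
  (Hgy : forall i, (i <= n)%nat -> g (x i) = y i)
  (Hgp : forall i, (i <= n)%nat -> dg (x i) = p i) :
  forall i, (1 <= i <= n)%nat ->
    let h := x i - x (i - 1)%nat in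
    let tau := (y i - y (i - 1)%nat) / h in
    let mu := 1 / 2 * (p (i - 1)%nat + p i) in
    let beta := beta_of_theta (theta i) in
    (mu <= 2 * tau ->
       theta i = 1 / 4 ->
       increasing_on (x (i - 1)%nat) (x i) g /\
       beta = -1 /\
       quadratic_spline_on (x (i - 1)%nat) (x i) g) /\
    (mu > 2 * tau ->
       let theta_bar := 1 / 2 * (tau / mu) in
       theta_bar < 1 / 4 /\
       (increasing_on (x (i - 1)%nat) (x i) g <-> theta i <= theta_bar) /\
       (theta i <= theta_bar -> V (x (i - 1)%nat) (x i) beta g)).
Proof.
  intros i Hi h tau mu beta.
  assert (HV : V (x (i - 1)%nat) (x i) beta g) by (apply Hg; exact Hi).
  pose proof (Htheta i Hi) as Hth.
  assert (Hlt : x (i - 1)%nat < x i) by (apply Hx; exact Hi).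
  pose proof (partition_bounds a b n x (i - 1) Hx ltac:(lia)) as Hbl.
  pose proof (partition_bounds a b n x i Hx ltac:(lia)) as Hbr.
  pose proof (Hp i ltac:(lia)) as Hp1.
  pose proof (Hp (i - 1)%nat ltac:(lia)) as Hp0.
  pose proof (Hy i Hi) as Hyi.
  pose proof HV as (df & Hdf & Hcdf & Hbis).
  unfold beta in Hbis; rewrite theta_of_beta_of_theta in Hbis by apply Hth.
  change (merrien_bisection (x (i - 1)%nat) (x i) (theta i) g df) in Hbis.
  (* The derivative in [V] and the one carrying the Hermite data are both
     derivatives of [g] on the subinterval. *)
  assert (Hdg' : deriv_on (x (i - 1)%nat) (x i) g dg)
    by (apply deriv_on_restrict with a b; (assumption || lra)).
  assert (Hd0 : df (x (i - 1)%nat) = p (i - 1)%nat).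
  { rewrite <- Hgp by lia.
    apply deriv_on_unique with (x (i - 1)%nat) (x i) g; try assumption; split; lra. }
  assert (Hd1 : df (x i) = p i).
  { rewrite <- Hgp by lia.
    apply deriv_on_unique with (x (i - 1)%nat) (x i) g; try assumption; split; lra. }
  assert (Hh : 0 < h) by (unfold h; lra).
  assert (Hmu : 0 < mu) by (unfold mu; lra).
  assert (Htauh : tau * h = y i - y (i - 1)%nat) by (unfold tau; field; lra).
  assert (Hinc : increasing_on (x (i - 1)%nat) (x i) g <-> theta i * (2 * mu) <= tau).
  { rewrite (merrien_increasing_iff _ _ (theta i) g df); try assumption; try lra.
    rewrite Hd0, Hd1, !Hgy, <- Htauh by lia; fold h.
    replace (p (i - 1)%nat + p i) with (2 * mu) by (unfold mu; field).
    split; [apply Rmult_le_reg_r, Hh|apply Rmult_le_compat_r; lra]. }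
  split.
  - intros Hmt Hq; rewrite Hq in *.
    split; [apply Hinc; lra|split].
    + unfold beta, beta_of_theta; rewrite Hq; field.
    + now apply merrien_quarter_quadratic_spline with df.
  - intros Hmt theta_bar.
    assert (Htb : theta_bar * (2 * mu) = tau) by (unfold theta_bar; field; lra).
    repeat split.
    + apply Rmult_lt_reg_r with (2 * mu); lra.
    + intros H; apply Hinc in H.
      apply Rmult_le_reg_r with (2 * mu); lra.
    + intros H; apply Hinc; rewrite <- Htb.
      apply Rmult_le_compat_r; lra.
    + intros _; exact HV.
Qed.
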